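(* Let $X$ be a nonempty set, $\Omega\subseteq\mathcal P(X)$ an algebra, $\mu$ a finite measure on $\Omega$ with outer measure $\mu^{*}$, and let $\overline{\Omega}$, $\widetilde{\mathbf S}$, $\sim$ and $F:\overline{\Omega}\to\widetilde{\mathbf S}/\!\sim$ be as described in the context. Then $F$ is a $\sigma$-algebra lattice isomorphism between $\overline{\Omega}$ and $\widetilde{\mathbf S}/\!\sim$: $F$ is a well-defined bijection and, for all $E,E',E_1,E_2,\dots\in\overline{\Omega}$, $F(E\vee E')=F(E)\cup F(E')$, $F(E\wedge E')=F(E)\cap F(E')$, $F(E^{C})=F(E)^{C}$, and $F(\vee_{i=1}^{\infty}E_i)=\bigcup_{i=1}^{\infty}F(E_i)$ (equalities in $\widetilde{\mathbf S}/\!\sim$).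
   Context: $\mu^{*}(A)=\inf\{\sum_i\mu(A_i):A_i\in\Omega,\ A\subseteq\bigcup_iA_i\}$. A sequence $\{B_n\}\subseteq\Omega$ is $\mu$-Cauchy if $\mu(B_n\triangle B_m)\to0$ as $n,m\to\infty$. $\overline{\Omega}$ is the set of equivalence classes $\overline{\{B_n\}}$ of $\mu$-Cauchy sequences, where $\{A_n\}$ and $\{B_n\}$ are equivalent iff $\lim_n\mu(A_n\triangle B_n)=0$. Operations on $\overline{\Omega}$: $\overline{\{A_n\}}\vee\overline{\{B_n\}}=\overline{\{A_n\cup B_n\}}$, $\overline{\{A_n\}}\wedge\overline{\{B_n\}}=\overline{\{A_n\cap B_n\}}$, $\overline{\{B_n\}}^{C}=\overline{\{B_n^{C}\}}$; $E\le E'$ means $E\wedge E'=E$; $\bar\mu(\overline{\{B_n\}})=\lim_n\mu(B_n)$. For $E_1,E_2,\dots\in\overline{\Omega}$, $\vee_{i=1}^{\infty}E_i$ is the unique $E\in\overline{\Omega}$ such that (1) $\vee_{i=1}^{n}E_i\le E$ for all $n$ and (2) $\lim_{n}\bar\mu(E\wedge(\vee_{i=1}^{n}E_i)^{C})=0$. $\widetilde{\mathbf S}=\{S\subseteq X:\exists\ \mu\text{-Cauchy }\{B_n\}\subseteq\Omega,\ \lim_n\mu^{*}(B_n\triangle S)=0\}$; $A\sim B$ iff $\mu^{*}(A\triangle B)=0$; the operations $\cup,\cap,{}^{C}$ and countable union on $\widetilde{\mathbf S}/\!\sim$ are induced from sets. $F(\overline{\{B_n\}})$ is the $\sim$-class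 of any $B\subseteq X$ with $\lim_n\mu^{*}(B_n\triangle B)=0$. *)

(* Defs.v *)
From HB Require Import structures.
From mathcomp Require Import all_boot all_order all_algebra.
From mathcomp Require Import generic_quotient.
From mathcomp Require Import lra.
From mathcomp Require Import all_classical all_reals all_analysis.

Set Implicit Arguments.
Unset Strict Implicit.
Unset Printing Implicit Defensive.

Import Order.TTheory GRing.Theory Num.Theory.
Import numFieldNormedType.Exports.

Local Open Scope classical_set_scope.
Local Open Scope ring_scope.
Local Open Scope ereal_scope.
Local Open Scope quotient_scope.
Local Open Scope measure_scope.

Section squeeze.
Context {T : Type} {F : set_system T} {FF : Filter F} {R : realType}.
Implicit Types f g h : T -> \bar R.

Lemma cvge0_le f g : (forall x, 0 <= f x) -> (forall x, f x <= g x) ->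
  g @ F --> 0 -> f @ F --> 0.
Proof.
move=> f0 fg g0; apply: (@squeeze_cvge _ _ _ _ (cst 0) _ g) => //.
  by apply: nearW => x; rewrite f0 fg.
exact: cvg_cst.
Qed.

Lemma cvge0_le2 f g h : (forall x, 0 <= f x) ->
  (forall x, f x <= g x + h x) -> g @ F --> 0 -> h @ F --> 0 -> f @ F --> 0.
Proof.
move=> f0 fgh g0 h0; apply: (cvge0_le f0 fgh).
by rewrite -[0 in X in _ --> X]adde0; exact: cvgeD.
Qed.

Lemma cvge0_lt f (e : R) : (0 < e)%R -> f @ F --> 0 ->
  \forall x \near F, f x < e%:E.
Proof.
move=> e0 f0; apply: (f0 [set y | y < e%:E]); apply: open_nbhs_nbhs.
by split; [exact: open_ereal_lt_ereal|rewrite /= lte_fin].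
Qed.

End squeeze.

Section outer_distance.
Context d (X : algebraOfSetsType d) (R : realType).
Variable mu : {measure set X -> \bar R}.
Implicit Types A B C S : set X.

Lemma outer_le A B : A `<=` B -> mu^* A <= mu^* B.
Proof. exact: le_mu_ext. Qed.

Lemma outer_ge0 A : 0 <= mu^* A.
Proof. exact: mu_ext_ge0. Qed.

Lemma outer_leU2 A B C : C `<=` A `|` B -> mu^* C <= mu^* A + mu^* B.
Proof.
move=> CAB; apply: le_trans (outer_measureU2 mu^* A B).
exact: outer_le.
Qed.

Lemma outer_setYC A B : mu^* (A `+` B) = mu^* (B `+` A).
Proof. by rewrite setYC. Qed.

Lemma outer_setYK A : mu^* (A `+` A) = 0.
Proof. by rewrite setYK mu_ext0. Qed.

Lemma outer_setY_trans B A C :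
  mu^* (A `+` C) <= mu^* (A `+` B) + mu^* (B `+` C).
Proof.
apply: outer_leU2 => x /=; have [Bx|Bx] := pselect (B x); tauto.
Qed.

Lemma outer_setYU A A' B B' :
  mu^* ((A `|` B) `+` (A' `|` B')) <= mu^* (A `+` A') + mu^* (B `+` B').
Proof.
apply: outer_leU2 => x /=.
have [Ax|Ax] := pselect (A x); have [Bx|Bx] := pselect (B x);
have [A'x|A'x] := pselect (A' x); have [B'x|B'x] := pselect (B' x); tauto.
Qed.

Lemma outer_setYI A A' B B' :
  mu^* ((A `&` B) `+` (A' `&` B')) <= mu^* (A `+` A') + mu^* (B `+` B').
Proof.
apply: outer_leU2 => x /=.
have [Ax|Ax] := pselect (A x); have [Bx|Bx] := pselect (B x);
have [A'x|A'x] := pselect (A' x); have [B'x|B'x] := pselect (B' x); tauto.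
Qed.

Lemma setY_setC A B : ~` A `+` ~` B = A `+` B.
Proof.
apply/seteqP; split => x /=;
  have [Ax|Ax] := pselect (A x); have [Bx|Bx] := pselect (B x); tauto.
Qed.

Lemma measurable_setY A B : measurable A -> measurable B ->
  measurable (A `+` B).
Proof. by move=> mA mB; apply: measurableU; exact: measurableD. Qed.

Lemma outer_setYE A B : measurable A -> measurable B ->
  mu (A `+` B) = mu^* (A `+` B).
Proof. by move=> mA mB; rewrite measurable_mu_extE//; exact: measurable_setY. Qed.

Lemma outer_setY_bigcup (S B : (set X)^nat) :
  mu^* (\bigcup_i S i `+` \bigcup_i B i) <= \sum_(i <oo) mu^* (S i `+` B i).
Proof.
apply: le_trans (outer_measure_sigma_subadditive mu^* _).
apply: outer_le => x /= [[[i _ Sx] nB]|[[i _ Bx] nS]]; exists i => //=.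
  by left; split=> // Bx; apply: nB; exists i.
by right; split=> // Sx; apply: nS; exists i.
Qed.

Lemma outer_bigcup_tail (finmu : mu setT < +oo) (B : (set X)^nat) :
  (forall i, measurable (B i)) ->
  mu^* (\bigcup_i B i `\` \big[setU/set0]_(i < n) B i) @[n --> \oo] --> 0.
Proof.
move=> mB; pose nu := measure_extension mu.
pose Y : measurableType _ := g_sigma_algebraType (@measurable _ X).
have mB' i : measurable (B i : set Y) by exact: sub_sigma_algebra.
pose G n : set Y := \bigcup_i B i `\` \big[setU/set0]_(i < n) B i.
have mG n : measurable (G n).
  apply: measurableD; first exact: bigcup_measurable.
  exact: bigsetU_measurable.
have G0 : \bigcap_n G n = set0.
  apply/seteqP; split=> // x Gx; have [[i _ Bx] _] := Gx 0%N I.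
  have [_] := Gx i.+1 I; apply; rewrite -bigcup_mkord; exists i => //=.
have := @nonincreasing_cvg_mu _ Y R nu G; rewrite G0 measure0; apply => //.
  apply: le_lt_trans finmu; rewrite /nu /measure_extension.
  by rewrite -(measurable_mu_extE mu measurableT); exact: outer_le.
move=> m n mn; apply/subsetPset; apply: setDS.
exact: subset_bigsetU.
Qed.

End outer_distance.

(* The algebra of subsets of the carrier is the type of measurable sets of
   [algebraOfSetsType]; the carrier is pointed, hence nonempty.  A [measure] on
   it is countably additive on disjoint unions that stay in the algebra, and
   [mu^*] is the infimum over countable covers by sets of the algebra. *)
Section completion.
Context d (X : algebraOfSetsType d) (R : realType).
Variable mu : {measure set X -> \bar R}.
Implicit Types S : set X.

Definition mu_cauchy : set (set X)^nat := [set B |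
  (forall n, measurable (B n)) /\
  mu (B nm.1 `+` B nm.2) @[nm --> (\oo, \oo)] --> 0].

Definition cauchy_seq : Type := {B : (set X)^nat | B \in mu_cauchy}.
HB.instance Definition _ := SubChoice.on cauchy_seq.

Lemma cauchy_seqP (B : cauchy_seq) : mu_cauchy (\val B).
Proof. by have := valP B; rewrite inE. Qed.

Definition CauchySeq (B : (set X)^nat) (cB : mu_cauchy B) : cauchy_seq := Sub B (mem_set cB).

Definition cauchy_equiv (A B : cauchy_seq) : bool :=
  `[< mu (\val A n `+` \val B n) @[n --> \oo] --> 0 >].

Lemma cauchy_measurable (B : cauchy_seq) n : measurable (\val B n).
Proof. by have [+ _] := cauchy_seqP B; apply. Qed.

Lemma cauchy_equivP (A B : cauchy_seq) : reflect
  (mu^* (\val A n `+` \val B n) @[n --> \oo] --> 0) (cauchy_equiv A B).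
Proof.
rewrite (_ : (fun n => mu^* _) = fun n => mu (\val A n `+` \val B n)).
  exact: asboolP.
by apply/funext => n; rewrite outer_setYE//; exact: cauchy_measurable.
Qed.

Lemma mu_cauchyP (B : (set X)^nat) : mu_cauchy B <-> (forall n, measurable (B n)) /\
  mu^* (B nm.1 `+` B nm.2) @[nm --> (\oo, \oo)] --> 0.
Proof.
suff E : (forall n, measurable (B n)) ->
    (fun nm => mu (B nm.1 `+` B nm.2)) =
    (fun nm => mu^* (B nm.1 `+` B nm.2)) :> (nat * nat -> \bar R).
  by split=> -[mB]; [rewrite (E mB)|rewrite -(E mB)].
by move=> mB; apply/funext => nm; rewrite outer_setYE.
Qed.

Lemma cauchy_equiv_refl : reflexive cauchy_equiv.
Proof.
move=> A; apply/cauchy_equivP.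
by under eq_fun do rewrite outer_setYK; exact: cvg_cst.
Qed.

Lemma cauchy_equiv_sym : symmetric cauchy_equiv.
Proof.
by move=> A B; apply/cauchy_equivP/cauchy_equivP => AB;
  under eq_fun do rewrite outer_setYC.
Qed.

Lemma cauchy_equiv_trans : transitive cauchy_equiv.
Proof.
move=> B A C /cauchy_equivP AB /cauchy_equivP BC; apply/cauchy_equivP.
apply: (cvge0_le2 _ _ AB BC) => n; first exact: outer_ge0.
exact: outer_setY_trans.
Qed.

Canonical cauchy_equiv_rel := EquivRel cauchy_equiv
  cauchy_equiv_refl cauchy_equiv_sym cauchy_equiv_trans.

Definition completion : Type := {eq_quot cauchy_equiv_rel}.
HB.instance Definition _ := Choice.on completion.
HB.instance Definition _ := EqQuotient.on completion.

Lemma cauchy_setU_subproof (A B : cauchy_seq) :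
  mu_cauchy (fun n => \val A n `|` \val B n).
Proof.
have /mu_cauchyP[mA cA] := cauchy_seqP A.
have /mu_cauchyP[mB cB] := cauchy_seqP B.
apply/mu_cauchyP; split=> [n|]; first exact: measurableU.
apply: (cvge0_le2 _ _ cA cB) => nm; first exact: outer_ge0.
exact: outer_setYU.
Qed.

Lemma cauchy_setI_subproof (A B : cauchy_seq) :
  mu_cauchy (fun n => \val A n `&` \val B n).
Proof.
have /mu_cauchyP[mA cA] := cauchy_seqP A.
have /mu_cauchyP[mB cB] := cauchy_seqP B.
apply/mu_cauchyP; split=> [n|]; first exact: measurableI.
apply: (cvge0_le2 _ _ cA cB) => nm; first exact: outer_ge0.
exact: outer_setYI.
Qed.

Lemma cauchy_setC_subproof (A : cauchy_seq) : mu_cauchy (fun n => ~` \val A n).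
Proof.
have [mA cA] := cauchy_seqP A; split=> [n|]; first exact: measurableC.
by under eq_fun do rewrite setY_setC.
Qed.

Lemma cauchy_set0_subproof : mu_cauchy (fun=> set0).
Proof.
by split=> //; under eq_fun do rewrite setYK measure0; exact: cvg_cst.
Qed.

Definition cauchy_setU (A B : cauchy_seq) := CauchySeq (cauchy_setU_subproof A B).
Definition cauchy_setI (A B : cauchy_seq) := CauchySeq (cauchy_setI_subproof A B).
Definition cauchy_setC (A : cauchy_seq) := CauchySeq (cauchy_setC_subproof A).
Definition cauchy_set0 := CauchySeq cauchy_set0_subproof.

(* The operations act on chosen representatives; [cjoin_pi], [cmeet_pi] and
   [ccompl_pi] show that they do not depend on the choice. *)
Definition cjoin (E E' : completion) : completion :=
  \pi_completion (cauchy_setU (repr E) (repr E')).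
Definition cmeet (E E' : completion) : completion :=
  \pi_completion (cauchy_setI (repr E) (repr E')).
Definition ccompl (E : completion) : completion :=
  \pi_completion (cauchy_setC (repr E)).
Definition cbot : completion := \pi_completion cauchy_set0.

Lemma completion_eqP (A B : cauchy_seq) :
  \pi_completion A = \pi_completion B <->
  mu^* (\val A n `+` \val B n) @[n --> \oo] --> 0.
Proof.
split=> [/eqmodP/cauchy_equivP//|AB]; exact/eqmodP/cauchy_equivP.
Qed.

Lemma repr_completion (A : cauchy_seq) :
  mu^* (\val (repr (\pi_completion A)) n `+` \val A n) @[n --> \oo] --> 0.
Proof. by apply/completion_eqP; rewrite reprK. Qed.

Lemma cjoin_pi (A B : cauchy_seq) :
  cjoin (\pi_completion A) (\pi_completion B) = \pi_completion (cauchy_setU A B).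
Proof.
apply/completion_eqP.
apply: (cvge0_le2 _ _ (repr_completion A) (repr_completion B)) => n.
  exact: outer_ge0.
exact: outer_setYU.
Qed.

Lemma cmeet_pi (A B : cauchy_seq) :
  cmeet (\pi_completion A) (\pi_completion B) = \pi_completion (cauchy_setI A B).
Proof.
apply/completion_eqP.
apply: (cvge0_le2 _ _ (repr_completion A) (repr_completion B)) => n.
  exact: outer_ge0.
exact: outer_setYI.
Qed.

Lemma ccompl_pi (A : cauchy_seq) :
  ccompl (\pi_completion A) = \pi_completion (cauchy_setC A).
Proof.
apply/completion_eqP; apply: (cvge0_le _ _ (repr_completion A)) => n.
  exact: outer_ge0.
by rewrite /= setY_setC.
Qed.

Definition cle (E E' : completion) : Prop := cmeet E E' = E.

(* See [cmu_pi]: for finite [mu] the limit exists and can be computed on any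
   representative. *)
Definition cmu (E : completion) : \bar R :=
  lim (mu (\val (repr E) n) @[n --> \oo]).

(* The sequence is indexed from 0, so [\big[cjoin/cbot]_(i < n) E_ i] is the join
   of its first [n] terms; for [n = 0] both requirements are harmless. *)
Definition is_bigcjoin (E_ : completion^nat) (E : completion) : Prop :=
  (forall n, cle (\big[cjoin/cbot]_(i < n) E_ i) E) /\
  cmu (cmeet E (ccompl (\big[cjoin/cbot]_(i < n) E_ i))) @[n --> \oo] --> 0.

(* For finite [mu] there is exactly one [E] with [is_bigcjoin E_ E]; the default
   value [cbot] is then never used. *)
Definition bigcjoin (E_ : completion^nat) : completion :=
  xget cbot [set E | is_bigcjoin E_ E].

Definition approx : set (set X) := [set S | exists2 B, mu_cauchy B &
  mu^* (B n `+` S) @[n --> \oo] --> 0].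

Definition approx_set : Type := {S : set X | S \in approx}.
HB.instance Definition _ := SubChoice.on approx_set.

Lemma approx_setP (S : approx_set) : approx (\val S).
Proof. by have := valP S; rewrite inE. Qed.

Definition ApproxSet S (aS : approx S) : approx_set := Sub S (mem_set aS).

Definition approx_equiv (S S' : approx_set) : bool :=
  `[< mu^* (\val S `+` \val S') = 0 >].

Lemma approx_equiv_refl : reflexive approx_equiv.
Proof. by move=> S; apply/asboolP; exact: outer_setYK. Qed.

Lemma approx_equiv_sym : symmetric approx_equiv.
Proof. by move=> S S'; rewrite /approx_equiv outer_setYC. Qed.

Lemma outer_le0 S : mu^* S <= 0 -> mu^* S = 0.
Proof. by move=> S0; apply/eqP; rewrite eq_le S0 outer_ge0. Qed.

Lemma approx_equiv_trans : transitive approx_equiv.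
Proof.
move=> B A C /asboolP AB /asboolP BC; apply/asboolP/outer_le0.
by rewrite (le_trans (outer_setY_trans _ (\val B) _ _))// AB BC adde0.
Qed.

Canonical approx_equiv_rel := EquivRel approx_equiv
  approx_equiv_refl approx_equiv_sym approx_equiv_trans.

Definition approx_quot : Type := {eq_quot approx_equiv_rel}.
HB.instance Definition _ := Choice.on approx_quot.
HB.instance Definition _ := EqQuotient.on approx_quot.

Lemma approx_set0_subproof : approx set0.
Proof.
exists (fun=> set0); first exact: cauchy_set0_subproof.
by under eq_fun do rewrite outer_setYK; exact: cvg_cst.
Qed.

Lemma approx_setU_subproof (S S' : approx_set) : approx (\val S `|` \val S').
Proof.
have [A cA AS] := approx_setP S; have [B cB BS'] := approx_setP S'.
exists (fun n => A n `|` B n).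
  exact: (cauchy_setU_subproof (CauchySeq cA) (CauchySeq cB)).
apply: (cvge0_le2 _ _ AS BS') => n; first exact: outer_ge0.
exact: outer_setYU.
Qed.

Lemma approx_setI_subproof (S S' : approx_set) : approx (\val S `&` \val S').
Proof.
have [A cA AS] := approx_setP S; have [B cB BS'] := approx_setP S'.
exists (fun n => A n `&` B n).
  exact: (cauchy_setI_subproof (CauchySeq cA) (CauchySeq cB)).
apply: (cvge0_le2 _ _ AS BS') => n; first exact: outer_ge0.
exact: outer_setYI.
Qed.

Lemma approx_setC_subproof (S : approx_set) : approx (~` \val S).
Proof.
have [A cA AS] := approx_setP S; exists (fun n => ~` A n).
  exact: (cauchy_setC_subproof (CauchySeq cA)).
by under eq_fun do rewrite setY_setC.
Qed.

Lemma approxP S :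
  (forall e : R, (0 < e)%R -> exists2 B, measurable B & mu^* (B `+` S) <= e%:E) ->
  approx S.
Proof.
move=> appS.
have /choice[B BS] : forall n, exists B,
    measurable B /\ mu^* (B `+` S) <= (n.+1%:R^-1)%R%:E.
  by move=> n; have [|B mB BS] := appS (n.+1%:R^-1)%R; [|exists B].
have BS0 : mu^* (B n `+` S) @[n --> \oo] --> 0.
  apply: (@cvge0_le _ _ _ _ _ (EFin \o harmonic)) => [n|n|].
  - exact: outer_ge0.
  - exact: (BS n).2.
  - by apply: cvg_EFin; [exact: nearW|exact: cvg_harmonic].
exists B => //; apply/mu_cauchyP; split=> [n|]; first exact: (BS n).1.
apply: (cvge0_le2 (g := fun nm => mu^* (B nm.1 `+` S))
                  (h := fun nm => mu^* (B nm.2 `+` S))) => [nm|nm||].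
- exact: outer_ge0.
- by rewrite (outer_setYC _ (B nm.2)); exact: outer_setY_trans.
- exact: (cvg_comp _ _ cvg_fst BS0).
- exact: (cvg_comp _ _ cvg_snd BS0).
Qed.

Lemma approx_adherent S (e : R) : approx S -> (0 < e)%R ->
  exists2 B, measurable B & mu^* (B `+` S) <= e%:E.
Proof.
move=> [B [mB _] BS] e0; have [n _ nBS] := cvge0_lt e0 BS.
by exists (B n) => //; apply/ltW/nBS => /=.
Qed.

Context (finmu : mu setT < +oo).

Lemma approx_bigcup_subproof (S_ : approx_set^nat) :
  approx (\bigcup_i \val (S_ i)).
Proof.
apply: approxP => e e0; have e20 : (0 < e / 2)%R by rewrite divr_gt0.
have /choice[B BS] : forall i, exists B, measurable B /\
    mu^* (B `+` \val (S_ i)) <= (e / 2 / (2 ^ i.+1)%:R)%R%:E.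
  move=> i; have [|B mB BS] := @approx_adherent _ (e / 2 / (2 ^ i.+1)%:R)%R
    (approx_setP (S_ i)); last by exists B.
  by rewrite divr_gt0// ltr0n expn_gt0.
have mB i : measurable (B i) := (BS i).1.
have [n _ /(_ n (leqnn n)) nB] := cvge0_lt e20 (outer_bigcup_tail finmu mB).
exists (\big[setU/set0]_(i < n) B i); first exact: bigsetU_measurable.
apply: le_trans (outer_setY_trans _ (\bigcup_i B i) _ _) _.
rewrite [e in leRHS]splitr EFinD; apply: leeD.
  apply: le_trans (ltW nB); apply: outer_le => x /= [[Bx nBx]|//].
  by case: nBx; move: Bx; rewrite -bigcup_mkord => -[i _ Bx]; exists i.
apply: le_trans (outer_setY_bigcup _ _ _) _.
apply: le_trans (epsilon_trick0 xpredT (ltW e20)).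
by apply: lee_nneseries => i *; [exact: outer_ge0|exact: (BS i).2].
Qed.

Definition approx_set0 := ApproxSet approx_set0_subproof.
Definition approx_setU (S S' : approx_set) :=
  ApproxSet (approx_setU_subproof S S').
Definition approx_setI (S S' : approx_set) :=
  ApproxSet (approx_setI_subproof S S').
Definition approx_setC (S : approx_set) := ApproxSet (approx_setC_subproof S).
Definition approx_bigcup (S_ : approx_set^nat) :=
  ApproxSet (approx_bigcup_subproof S_).

(* Independence of representatives: [qcup_pi], [qcap_pi], [qcompl_pi] and
   [qbigcup_pi].  Finiteness of [mu] is needed for the countable union of sets
   in [approx] to be in [approx]. *)
Definition qcup (Y Y' : approx_quot) : approx_quot :=
  \pi_approx_quot (approx_setU (repr Y) (repr Y')).
Definition qcap (Y Y' : approx_quot) : approx_quot :=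
  \pi_approx_quot (approx_setI (repr Y) (repr Y')).
Definition qcompl (Y : approx_quot) : approx_quot :=
  \pi_approx_quot (approx_setC (repr Y)).
Definition qbigcup (Y_ : approx_quot^nat) : approx_quot :=
  \pi_approx_quot (approx_bigcup (fun i => repr (Y_ i))).

Lemma approx_quot_eqP (S S' : approx_set) :
  \pi_approx_quot S = \pi_approx_quot S' <->
  mu^* (\val S `+` \val S') = 0.
Proof. by split=> [/eqmodP/asboolP//|SS']; exact/eqmodP/asboolP. Qed.

Lemma repr_approx_quot (S : approx_set) :
  mu^* (\val (repr (\pi_approx_quot S)) `+` \val S) = 0.
Proof. by apply/approx_quot_eqP; rewrite reprK. Qed.

Lemma qcup_pi (S S' : approx_set) :
  qcup (\pi_approx_quot S) (\pi_approx_quot S') =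
  \pi_approx_quot (approx_setU S S').
Proof.
apply/approx_quot_eqP/outer_le0; apply: le_trans (outer_setYU _ _ _ _ _) _.
by rewrite !repr_approx_quot adde0.
Qed.

Lemma qcap_pi (S S' : approx_set) :
  qcap (\pi_approx_quot S) (\pi_approx_quot S') =
  \pi_approx_quot (approx_setI S S').
Proof.
apply/approx_quot_eqP/outer_le0; apply: le_trans (outer_setYI _ _ _ _ _) _.
by rewrite !repr_approx_quot adde0.
Qed.

Lemma qcompl_pi (S : approx_set) :
  qcompl (\pi_approx_quot S) = \pi_approx_quot (approx_setC S).
Proof. by apply/approx_quot_eqP; rewrite /= setY_setC repr_approx_quot. Qed.

Lemma qbigcup_pi (S_ : approx_set^nat) :
  qbigcup (fun i => \pi_approx_quot (S_ i)) =
  \pi_approx_quot (approx_bigcup S_).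
Proof.
apply/approx_quot_eqP/outer_le0; apply: le_trans (outer_setY_bigcup _ _ _) _.
by rewrite eseries0// => i _ _; exact: repr_approx_quot.
Qed.

Lemma mu_fin (A : set X) : measurable A -> mu A \is a fin_num.
Proof. by move=> mA; exact: (lty_fin_num_fun finmu). Qed.

Lemma mu_le_setY (A B : set X) : measurable A -> measurable B ->
  mu A <= mu B + mu (A `+` B).
Proof.
move=> mA mB; rewrite outer_setYE// -!(measurable_mu_extE mu)//.
by apply: outer_leU2 => x /= Ax; have [Bx|Bx] := pselect (B x); tauto.
Qed.

Lemma cauchy_seq_cvg_mu (B : cauchy_seq) : cvg (mu (\val B n) @[n --> \oo]).
Proof.
have [mB cB] := cauchy_seqP B; pose u n := fine (mu (\val B n)).
have uE n : mu (\val B n) = (u n)%:E by rewrite /u fineK// mu_fin.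
suff : cvg (u @ \oo).
  move=> /cvg_ex[l ul]; apply/cvg_ex; exists l%:E.
  by under eq_fun do rewrite uE; apply: cvg_EFin => //; exact: nearW.
apply/cauchy_cvgP/cauchy_ballP => e e0.
have [[P Q]/= [nP nQ] PQ] := cvge0_lt e0 cB.
exists (u @` P, u @` Q) => /=.
  split; [move: nP|move: nQ]; apply: filterS => n ? ; by exists n.
move=> [_ _] /= [[n Pn <-] [m Qm <-]]; rewrite /ball/= ltr_norml.
have := PQ (n, m) (conj Pn Qm); rewrite /= => De.
have mY : measurable (\val B n `+` \val B m) by exact: measurable_setY.
have := mu_le_setY (mB n) (mB m).
have := mu_le_setY (mB m) (mB n); rewrite setYC !uE.
move: De; rewrite -(fineK (mu_fin mY)) -!EFinD lte_fin !lee_fin => De h1 h2.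
by apply/andP; split; lra.
Qed.

Lemma cmu_pi (B : cauchy_seq) :
  mu (\val B n) @[n --> \oo] --> cmu (\pi_completion B).
Proof.
set A := repr (\pi_completion B); have cA := @cauchy_seq_cvg_mu A.
have AB0 : mu (\val A n `+` \val B n) @[n --> \oo] --> 0.
  apply: (cvge0_le _ _ (repr_completion B)) => n; first exact: measure_ge0.
  by rewrite outer_setYE//; exact: cauchy_measurable.
have mA := cauchy_measurable A; have mB := cauchy_measurable B.
have AB n : mu (\val A n) <= mu (\val B n) + mu (\val A n `+` \val B n).
  exact: mu_le_setY.
have BA n : mu (\val B n) <= mu (\val A n) + mu (\val A n `+` \val B n).
  by rewrite setYC; exact: mu_le_setY.
apply: (@squeeze_cvge _ _ _ _
  (fun n => mu (\val A n) - mu (\val A n `+` \val B n)) _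
  (fun n => mu (\val A n) + mu (\val A n `+` \val B n))).
- apply: nearW => n; rewrite BA andbT leeBlDr ?AB//.
  by apply: mu_fin; exact: measurable_setY.
- rewrite -[cmu _]sube0; apply: cvgeB => //.
  by rewrite fin_num_adde_defl// fin_numN.
- rewrite -[cmu _]adde0; apply: cvgeD => //.
  by rewrite fin_num_adde_defl.
Qed.

Definition limit_class (E : completion) (Y : approx_quot) : Prop :=
  exists (B : cauchy_seq) (S : approx_set),
    [/\ E = \pi_completion B, Y = \pi_approx_quot S &
      mu^* (\val B n `+` \val S) @[n --> \oo] --> 0].

(* For finite [mu], [limit_class E] holds of exactly one class, and the default
   value is never used. *)
Definition limit_map (E : completion) : approx_quot :=
  xget (\pi_approx_quot approx_set0)
    [set Y | limit_class E Y].

End completion.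

(* Main.v *)
(* If the outer measures of B_n + B_n.+1 (symmetric difference) are summable, a
   point outside the union of these differences over n >= N belongs to B_N iff it
   belongs to limsup B; hence B_n tends to limsup B, and every Cauchy sequence
   has a limit set.  As the outer measure of symmetric differences is a
   pseudo-metric for which the set operations are continuous, F is a bijection
   commuting with the finite operations.  For countable joins, a class E with
   limit S is the join of the E_i exactly when S contains each finite union of
   the limits S_i up to a null set and the outer measure of the rest of S tends
   to 0; this characterizes the class of the union of the S_i. *)
Require Import Defs.
From mathcomp Require Import all_boot all_order all_algebra.
From mathcomp Require Import generic_quotient.
From mathcomp Require Import all_classical all_reals all_analysis.

Local Open Scope classical_set_scope.
Local Open Scope ring_scope.
Local Open Scope ereal_scope.

Section limit_sets.
Set Implicit Arguments.
Unset Strict Implicit.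
Import Order.TTheory GRing.Theory Num.Theory.
Import numFieldNormedType.Exports.
Local Open Scope quotient_scope.
Local Open Scope measure_scope.
Context d (X : algebraOfSetsType d) (R : realType).
Variable mu : {measure set X -> \bar R}.
Implicit Types (B : (set X)^nat) (S : set X).

(** * Convergence to a set and convergence to 0 in the extended reals *)

Definition tends_to B S := mu^* (B n `+` S) @[n --> \oo] --> 0.

(** Serves to show that a fixed set is null: bound its outer measure by quantities that tend to
    0. *)
Lemma cvge0_const (c : \bar R) (f : (\bar R)^nat) : 0 <= c ->
  (forall n, c <= f n) -> f @ \oo --> 0 -> c = 0.
Proof.
move=> c0 cf f0; apply: (@cvg_unique _ _ (cst c @ \oo)) => //.
  exact: cvg_cst.
exact: (cvge0_le _ cf).
Qed.

Lemma cvge0_near (f : (\bar R)^nat) : (forall n, 0 <= f n) ->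
  (forall e : R, (0 < e)%R -> \forall n \near \oo, f n <= e%:E) ->
  f @ \oo --> 0.
Proof.
move=> f0 fe; apply/fine_cvgP; split.
  (* The bound for [e] = 1 already makes the values eventually finite. *)
  apply: filterS (fe 1%R ltr01) => n fn1.
  by rewrite fin_numElt (lt_le_trans _ (f0 n))//= (le_lt_trans fn1)// ltry.
apply/cvgr0Pnorm_le => e e0; apply: filterS (fe e e0) => n fne.
rewrite ger0_norm ?fine_ge0// -lee_fin fineK// fin_numElt.
by rewrite (lt_le_trans _ (f0 n))//= (le_lt_trans fne)// ltry.
Qed.

(** * Completeness: a limit set for every Cauchy sequence *)

Lemma limsup_setY_sub B N :
  B N `+` lim_sup_set B `<=` \bigcup_k (B (N + k)%N `+` B (N + k.+1)%N).
Proof.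
move=> x BNx; apply: contrapT => nU.
have BNk k : B (N + k)%N x <-> B N x.
  elim: k => [|k <-]; first by rewrite addn0.
  have nk : ~ (B (N + k)%N `+` B (N + k.+1)%N) x by move=> ?; apply: nU; exists k.
  move: nk => /=; have [p|p] := pselect (B (N + k)%N x);
  have [q|q] := pselect (B (N + k.+1)%N x); tauto.
have BN n : (N <= n)%N -> B n x <-> B N x.
  by move=> Nn; rewrite -(subnKC Nn); exact: BNk.
case: BNx => -[p q].
  apply: q => n _; exists (maxn N n); first by rewrite /= leq_maxr.
  by apply/BN => //; exact: leq_maxl.
by have [m /= Nm Bm] := p N I; apply: q; exact/(BN _ Nm).
Qed.

Lemma tends_to_limsup B :
  (forall n, mu^* (B n `+` B n.+1) <= (2^-1 ^+ n)%:E) ->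
  tends_to B (lim_sup_set B).
Proof.
move=> Bfast.
apply: (@cvge0_le _ _ _ _ _ (fun n => (2%R * 2^-1 ^+ n)%:E)) => [n|N|].
- exact: outer_ge0.
- apply: le_trans (le_mu_ext mu (@limsup_setY_sub B N)) _.
  apply: le_trans (outer_measure_sigma_subadditive mu^* _) _.
  (* With total 2 * 2^-N, the [i]-th term in [epsilon_trick0] is 2^-(N+i), the bound from
     [Bfast]. *)
  have e0 : (0 <= 2 * 2^-1 ^+ N :> R)%R by rewrite mulr_ge0// exprn_ge0.
  apply: le_trans (epsilon_trick0 xpredT e0).
  apply: lee_nneseries => i *; first exact: outer_ge0.
  rewrite addnS; apply: le_trans (Bfast _) _; rewrite lee_fin.
  rewrite natrX -exprVn exprS mulrACA divff// ?mul1r ?exprD//.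
- apply: cvg_EFin; first exact: nearW.
  rewrite -[0%R in X in _ --> X](mulr0 2%R); apply: cvgMl_tmp => //.
  by apply: cvg_expr; rewrite ger0_norm ?invr_ge0// invf_lt1// ltr1n.
Qed.

Lemma cauchy_near B (e : R) : mu_cauchy mu B -> (0 < e)%R -> exists N,
  forall n m, (N <= n)%N -> (N <= m)%N -> mu^* (B n `+` B m) < e%:E.
Proof.
move=> /mu_cauchyP[_ cB] e0.
have [[P Q]/= [[N1 _ NP] [N2 _ NQ]] PQ] := cvge0_lt e0 cB.
exists (maxn N1 N2) => n m; rewrite !geq_max => /andP[n1 _] /andP[_ m2].
by apply: (PQ (n, m)); split; [exact: NP|exact: NQ].
Qed.

Lemma tends_to_exists B : mu_cauchy mu B -> exists S, tends_to B S.
Proof.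
move=> cB.
have /choice[N BN] : forall k, exists N, forall n m, (N <= n)%N -> (N <= m)%N ->
    mu^* (B n `+` B m) < (2^-1 ^+ k)%:E.
  by move=> k; apply: cauchy_near => //; rewrite exprn_gt0.
(* The running maximum gives [N k <= r k] and [N k <= r k.+1], so consecutive sets of [B \o r] are
   2^-k close; [k <= r k] brings [B (r n)] close to [B n] for large [n]. *)
pose r k := maxn k (\max_(i < k.+1) N i).
have Nr k : (N k <= r k)%N.
  apply: leq_trans (leq_maxr _ _).
  exact: (@leq_bigmax _ (fun i : 'I_k.+1 => N i) ord_max).
have Nr1 k : (N k <= r k.+1)%N.
  apply: leq_trans (leq_maxr _ _); rewrite big_ord_recr/=.
  apply: leq_trans (leq_maxl _ _).
  exact: (@leq_bigmax _ (fun i : 'I_k.+1 => N i) ord_max).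
have rS : tends_to (B \o r) (lim_sup_set (B \o r)).
  by apply: tends_to_limsup => k; exact/ltW/BN.
set S := lim_sup_set _ in rS; exists S.
apply: (cvge0_le2 (g := fun n => mu^* (B n `+` B (r n))) _ _ _ rS) => [n|n|].
- exact: outer_ge0.
- exact: outer_setY_trans.
- apply: cvge0_near => [n|e e0]; first exact: outer_ge0.
  have [M MB] := cauchy_near cB e0; exists M => //= n Mn.
  by apply/ltW/MB => //; rewrite (leq_trans Mn)// leq_maxl.
Qed.

(** * Limit sets of classes *)

(** Relates a class to plain sets, so that operations are compared before passing to the quotient by
    null sets. *)
Definition has_limit (E : completion mu) S :=
  exists2 B : cauchy_seq mu, E = \pi_(completion mu) B & tends_to (\val B) S.

(** Triangle inequality along S, B_n, B'_n, S'. Left to right it makes F well defined, right to left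
    injective. *)
Lemma has_limit_eqP (E E' : completion mu) S S' :
  has_limit E S -> has_limit E' S' -> E = E' <-> mu^* (S `+` S') = 0.
Proof.
move=> [B -> BS] [B' -> BS']; rewrite completion_eqP; split=> [BB'|SS'].
  apply: (cvge0_const (f := fun n => mu^* (\val B n `+` S) +
    (mu^* (\val B n `+` \val B' n) + mu^* (\val B' n `+` S')))).
  - exact: outer_ge0.
  - move=> n; apply: le_trans (outer_setY_trans _ (\val B n) _ _) _.
    by rewrite outer_setYC leeD2l//; exact: outer_setY_trans.
  - rewrite -[0 in X in _ --> X](adde0 0); apply: cvgeD => //.
    by rewrite -[0 in X in _ --> X](adde0 0); exact: cvgeD.
apply: (cvge0_le2 _ _ BS BS') => n; first exact: outer_ge0.
apply: le_trans (outer_setY_trans _ S _ _) _; rewrite leeD2l//.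
apply: le_trans (outer_setY_trans _ S' _ _) _.
by rewrite SS' add0e outer_setYC.
Qed.

Lemma has_limit_ae (E : completion mu) S S' :
  mu^* (S `+` S') = 0 -> has_limit E S -> has_limit E S'.
Proof.
move=> SS' [B -> BS]; exists B => //; apply: cvge0_le BS => n.
  exact: outer_ge0.
by apply: le_trans (outer_setY_trans _ S _ _) _; rewrite SS' adde0.
Qed.

Lemma has_limit_exists (E : completion mu) : exists S, has_limit E S.
Proof.
have [S BS] := tends_to_exists (cauchy_seqP (repr E)).
by exists S, (repr E); rewrite ?reprK.
Qed.

Lemma has_limit_approx (E : completion mu) S : has_limit E S -> Defs.approx mu S.
Proof. by move=> [B _ BS]; exists (\val B) => //; exact: cauchy_seqP. Qed.

Lemma approx_has_limit S : Defs.approx mu S -> exists E, has_limit E S.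
Proof.
by move=> [B cB BS]; exists (\pi_(completion mu) (CauchySeq cB)), (CauchySeq cB).
Qed.

Lemma has_limitU (E E' : completion mu) S S' :
  has_limit E S -> has_limit E' S' -> has_limit (cjoin E E') (S `|` S').
Proof.
move=> [B -> BS] [B' -> BS']; rewrite cjoin_pi; exists (cauchy_setU B B') => //.
apply: (cvge0_le2 _ _ BS BS') => n; first exact: outer_ge0.
exact: outer_setYU.
Qed.

Lemma has_limitI (E E' : completion mu) S S' :
  has_limit E S -> has_limit E' S' -> has_limit (cmeet E E') (S `&` S').
Proof.
move=> [B -> BS] [B' -> BS']; rewrite cmeet_pi; exists (cauchy_setI B B') => //.
apply: (cvge0_le2 _ _ BS BS') => n; first exact: outer_ge0.
exact: outer_setYI.
Qed.

Lemma has_limitC (E : completion mu) S : has_limit E S -> has_limit (ccompl E) (~` S).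
Proof.
move=> [B -> BS]; rewrite ccompl_pi; exists (cauchy_setC B) => //.
by rewrite /tends_to; under eq_fun do rewrite /= setY_setC.
Qed.

Lemma has_limit0 : has_limit (cbot mu) set0.
Proof.
exists (cauchy_set0 mu) => //; rewrite /tends_to.
by under eq_fun do rewrite /= outer_setYK; exact: cvg_cst.
Qed.

Lemma has_limit_bigU (E_ : (completion mu)^nat) (S_ : (set X)^nat) n :
  (forall i, has_limit (E_ i) (S_ i)) ->
  has_limit (\big[@cjoin _ _ _ mu/cbot mu]_(i < n) E_ i)
            (\big[setU/set0]_(i < n) S_ i).
Proof.
move=> ES; apply: (big_rec2 has_limit); first exact: has_limit0.
by move=> i E S _; exact: has_limitU.
Qed.

(** * The map F and its bijectivity *)

Lemma limit_classP (E : completion mu) (S : approx_set mu) :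
  limit_class E (\pi_(approx_quot mu) S) <-> has_limit E (\val S).
Proof.
split=> [[B [S' [-> /approx_quot_eqP SS' BS]]]|[B EB BS]]; last by exists B, S.
by apply: has_limit_ae (ex_intro2 _ _ B erefl BS); rewrite outer_setYC.
Qed.

Lemma limit_class_unique (E : completion mu) : exists! Y, limit_class E Y.
Proof.
have [S ES] := has_limit_exists E.
exists (\pi_(approx_quot mu) (ApproxSet (has_limit_approx ES))); split.
  exact/limit_classP.
move=> Y; rewrite -[Y]reprK => /limit_classP EY.
exact/approx_quot_eqP/(has_limit_eqP ES EY).
Qed.

Lemma limit_mapE (E : completion mu) (S : approx_set mu) :
  has_limit E (\val S) -> limit_map E = \pi_(approx_quot mu) S.
Proof.
move=> /limit_classP ES; have [Y [EY YE]] := limit_class_unique E.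
rewrite -(YE _ ES); apply/esym/YE; rewrite /limit_map.
(* The witness [Y] rules out the default value of [xget]. *)
by case: xgetP => // /(_ Y).
Qed.

Lemma has_limit_map (E : completion mu) : exists2 S : approx_set mu,
  has_limit E (\val S) & limit_map E = \pi_(approx_quot mu) S.
Proof.
have [S ES] := has_limit_exists E.
by exists (ApproxSet (has_limit_approx ES)) => //; exact: limit_mapE.
Qed.

Lemma limit_map_bij : bijective (@limit_map _ _ _ mu).
Proof.
(* The inverse sends [Y] to the class of a Cauchy sequence that tends to a representative of [Y]. *)
have /choice[g gP] : forall Y : approx_quot mu, exists E, has_limit E (\val (repr Y)).
  by move=> Y; exact/approx_has_limit/approx_setP.
exists g => [E|Y]; last by rewrite (limit_mapE (gP Y)) reprK.
have [S ES ->] := has_limit_map E.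
by apply/(has_limit_eqP (gP _) ES); exact: repr_approx_quot.
Qed.

(** * Countable joins for a finite measure *)

Section finite_measure.
Context (finmu : mu setT < +oo).

Lemma outer_fin S : mu^* S \is a fin_num.
Proof.
rewrite fin_numElt (lt_le_trans _ (outer_ge0 mu S))//=.
apply: le_lt_trans finmu; rewrite -(measurable_mu_extE mu measurableT).
exact: outer_le.
Qed.

(** Squeeze between the outer measure of S minus and plus that of the difference of B_n and S. It
    turns condition (2) of the countable join into one on sets. *)
Lemma cmu_has_limit (E : completion mu) S : has_limit E S -> cmu E = mu^* S.
Proof.
move=> [B -> BS]; apply: (@cvg_unique _ _ (mu (\val B n) @[n --> \oo])) => //; first exact: cmu_pi.
have muB n : mu (\val B n) = mu^* (\val B n).
  by rewrite measurable_mu_extE//; exact: cauchy_measurable.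
apply: (@squeeze_cvge _ _ _ _ (fun n => mu^* S - mu^* (\val B n `+` S)) _
  (fun n => mu^* S + mu^* (\val B n `+` S))).
- apply: nearW => n; rewrite muB leeBlDr ?outer_fin//; apply/andP; split;
    apply: outer_leU2 => x /= Sx; have [Bx|Bx] := pselect (\val B n x);
    have [S'x|S'x] := pselect (S x); tauto.
- rewrite -[X in _ --> X]sube0; apply: cvgeB => //; last exact: cvg_cst.
  by rewrite fin_num_adde_defl// fin_numN.
- rewrite -[X in _ --> X]adde0; apply: cvgeD => //; last exact: cvg_cst.
  by rewrite fin_num_adde_defl.
Qed.

(** Replace each [S_ i] by a set of the algebra with error e/2^(i+2): the tail for the algebra sets
    is eventually below e/2, and the errors sum to at most e/2. *)
Lemma outer_bigcup_tail_approx (S_ : (set X)^nat) :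
  (forall i, Defs.approx mu (S_ i)) ->
  mu^* (\bigcup_i S_ i `\` \big[setU/set0]_(i < n) S_ i) @[n --> \oo] --> 0.
Proof.
move=> aS; apply: cvge0_near => [n|e e0]; first exact: outer_ge0.
have e20 : (0 < e / 2)%R by rewrite divr_gt0.
have /choice[B BS] : forall i, exists A, measurable A /\
    mu^* (A `+` S_ i) <= (e / 2 / (2 ^ i.+1)%:R)%R%:E.
  move=> i; have [|A mA AS] := approx_adherent (e := (e / 2 / (2 ^ i.+1)%:R)%R) (aS i);
    last by exists A.
  by rewrite divr_gt0// ltr0n expn_gt0.
have mB i : measurable (B i) := (BS i).1.
apply: filterS (cvge0_lt e20 (outer_bigcup_tail finmu mB)) => n nB.
rewrite [e in leRHS]splitr EFinD; apply: le_trans (leeD (ltW nB) _).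
  apply: outer_leU2 (\bigcup_i (B i `+` S_ i)) _ _.
  move=> x /= [[i _ Sx] nS]; apply: contrapT => nU.
  (* Outside all the differences the two sequences agree at [x], so their tails do too. *)
  have BSx j : S_ j x <-> B j x.
    have nj : ~ (B j `+` S_ j) x by move=> ?; apply: nU; right; exists j.
    move: nj => /=; have [p|p] := pselect (B j x);
    have [q|q] := pselect (S_ j x); tauto.
  apply: nU; left; split; first by exists i => //; exact/BSx.
  rewrite -bigcup_mkord => -[j jn Bx]; apply: nS.
  by rewrite -bigcup_mkord; exists j => //; exact/BSx.
apply: le_trans (outer_measure_sigma_subadditive mu^* _) _.
apply: le_trans (epsilon_trick0 xpredT (ltW e20)).
by apply: lee_nneseries => i *; [exact: outer_ge0|exact: (BS i).2].
Qed.

Lemma is_bigcjoinP (E_ : (completion mu)^nat) (S_ : (set X)^nat)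
    (E : completion mu) S :
  (forall i, has_limit (E_ i) (S_ i)) -> has_limit E S ->
  is_bigcjoin E_ E <-> mu^* (S `+` \bigcup_i S_ i) = 0.
Proof.
move=> ES_ ES; set T := \bigcup_i S_ i.
pose P n := \big[setU/set0]_(i < n) S_ i.
have JP n := has_limit_bigU n ES_; rewrite -/(P _) in JP.
have PT n : P n `<=` T.
  by rewrite /P -bigcup_mkord => x [i _ Sx]; exists i.
have TP : mu^* (T `\` P n) @[n --> \oo] --> 0.
  by apply: outer_bigcup_tail_approx => i; exact: has_limit_approx (ES_ i).
(* Condition (1) now says that [P n] minus [S] is null, and (2) that [S] minus [P n] has outer
   measure tending to 0. *)
have cleP n := has_limit_eqP (has_limitI (JP n) ES) (JP n).
have cmuP n := cmu_has_limit (has_limitI ES (has_limitC (JP n))).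
rewrite /is_bigcjoin; under eq_fun do rewrite cmuP.
split=> [[JE SP]|ST].
  apply: (cvge0_const (f := fun n => mu^* (S `&` ~` P n) + mu^* (T `\` P n))).
  - exact: outer_ge0.
  (* A point of the difference of [S] and [T] is in [P n] but not in [S], a null set by (1), or
     outside [P n] and in [S] or [T]. *)
  - move=> n; rewrite -[leRHS]add0e -((cleP n).1 (JE n)).
    apply: le_trans (leeD2l _ (outer_measureU2 mu^* _ _)).
    apply: outer_leU2 => x /=; have := PT n x.
    have [p|p] := pselect (P n x); have [q|q] := pselect (S x); tauto.
  - by rewrite -[0 in X in _ --> X](adde0 0); exact: cvgeD.
split=> [n|].
  apply/(cleP n)/outer_le0; rewrite -ST; apply: outer_le => x /=; have := PT n x.
  have [p|p] := pselect (P n x); have [q|q] := pselect (S x); tauto.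
apply: cvge0_le TP => n; first exact: outer_ge0.
rewrite -[leRHS]add0e -ST; apply: outer_leU2 => x /=.
have [p|p] := pselect (T x); tauto.
Qed.

Lemma has_limit_bigcup (E_ : (completion mu)^nat) (S_ : (approx_set mu)^nat) :
  (forall i, has_limit (E_ i) (\val (S_ i))) ->
  has_limit (bigcjoin E_) (\bigcup_i \val (S_ i)).
Proof.
move=> ES_.
have [E ET] := approx_has_limit (approx_setP (approx_bigcup finmu S_)).
(* A join exists, so [bigcjoin] is not the default value; the converse direction then identifies its
   limit set up to a null set. *)
have EJ : is_bigcjoin E_ E by apply/(is_bigcjoinP ES_ ET); exact: outer_setYK.
have [S JS] := has_limit_exists (bigcjoin E_).
apply: has_limit_ae (JS); apply/(is_bigcjoinP ES_ JS).
by rewrite /bigcjoin; case: xgetP => // /(_ E).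
Qed.

End finite_measure.

End limit_sets.

Theorem theorem4 (d : measure_display) (X : algebraOfSetsType d) (R : realType)
    (mu : {measure set X -> \bar R}) (finmu : mu [set: X] < +oo) :
  (forall E : completion mu, exists! Y : approx_quot mu, limit_class E Y) /\
  bijective (fun E : completion mu => limit_map E) /\
  (forall E E' : completion mu,
    limit_map (cjoin E E') = qcup (limit_map E) (limit_map E')) /\
  (forall E E' : completion mu,
    limit_map (cmeet E E') = qcap (limit_map E) (limit_map E')) /\
  (forall E : completion mu,
    limit_map (ccompl E) = qcompl (limit_map E)) /\
  (forall E_ : nat -> completion mu,
    limit_map (bigcjoin E_) = qbigcup finmu (fun i => limit_map (E_ i))).
Proof.
split; first exact: limit_class_unique.
split; first exact: limit_map_bij.
split=> [E E'|].
  have [S ES ->] := has_limit_map E; have [S' ES' ->] := has_limit_map E'.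
  by rewrite qcup_pi; apply: limit_mapE; exact: has_limitU.
split=> [E E'|].
  have [S ES ->] := has_limit_map E; have [S' ES' ->] := has_limit_map E'.
  by rewrite qcap_pi; apply: limit_mapE; exact: has_limitI.
split=> [E|E_].
  have [S ES ->] := has_limit_map E.
  by rewrite qcompl_pi; apply: limit_mapE; exact: has_limitC.
(* Choosing a limit set for every [i] at once writes all classes as projections, the form
   [qbigcup_pi] needs. *)
have /choice[S_ ES_] : forall i, exists S : approx_set mu,
    has_limit (E_ i) (\val S) /\ limit_map (E_ i) = (\pi_(approx_quot mu) S)%qT.
  by move=> i; have [S ES ->] := has_limit_map (E_ i); exists S.
have -> : (fun i => limit_map (E_ i)) = fun i => (\pi_(approx_quot mu) (S_ i))%qT.
  by apply/funext => i; exact: (ES_ i).2.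
rewrite qbigcup_pi; apply: limit_mapE; apply: has_limit_bigcup => // i.
exact: (ES_ i).1.
Qed.
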